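(* Let $G$ be a finite simple connected graph with at least one edge, with maximum degree $\Delta$ and minimum degree $\delta$, and let $\alpha>0$. Then $$k_\alpha\sqrt{R_\alpha(G)R_{-\alpha}(G)}\le GA_1(G)\le \sqrt{R_\alpha(G)R_{-\alpha}(G)},$$ where $$k_\alpha:=\begin{cases}\dfrac{2\Delta^{1/2}\delta^{3/2}}{\Delta^2+\delta^2}, & \text{if } 0<\alpha\le 1,\\[2ex] \dfrac{2\Delta^{\alpha-1/2}\delta^{\alpha+1/2}}{\Delta^{2\alpha}+\delta^{2\alpha}}, & \text{if } \alpha\ge 1,\end{cases}$$ and each of the two equalities holds if and only if $G$ is a regular graph.
   Context: For a graph $G$ with vertex set $V(G)$ and edge set $E(G)$, $d_u$ denotes the degree of the vertex $u$. The first geometric-arithmetic index is $GA_1(G)=\sum_{uv\in E(G)}\frac{2\sqrt{d_ud_v}}{d_u+d_v}$. For $\beta\in\mathbb{R}\setminus\{0\}$ the general Randić index is $R_\beta(G)=\sum_{uv\in E(G)}(d_ud_v)^\beta$. *)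

(* Defs.v *)
From HB Require Import structures.
From mathcomp Require Import all_boot all_order all_algebra.
From mathcomp Require Import reals exp.
Set Implicit Arguments.
Unset Strict Implicit.
Unset Printing Implicit Defensive.
Import Order.TTheory GRing.Theory Num.Theory.
Local Open Scope ring_scope.

Record sgraph := SGraph {
  vertex :> finType;
  adj : rel vertex;
  adj_sym : symmetric adj;
  adj_irrefl : irreflexive adj }.

Section Graph.
Variable G : sgraph.
Implicit Types u v : G.

Definition edges : {set {set G}} :=
  [set [set u; v] | u in G, v in G & adj u v].

Definition degree u : nat := #|[set v | adj u v]|.

Definition max_degree : nat := (\max_(u : G) degree u)%N.

(* Degrees are < #|G|, so the default #|G| is inert when G has a vertex. *)
Definition min_degree : nat := \big[minn/#|G|]_(u : G) degree u.

Definition graph_connected : Prop := forall u v, connect (@adj G) u v.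

Definition graph_regular : Prop := exists k : nat, forall u, degree u = k.

End Graph.

Section Indices.
Variables (R : realType) (G : sgraph).

(* Edges are two-element sets, so for A = {u, v} the product and the sum of
   the degrees over A are d_u d_v and d_u + d_v. *)
Definition GA1 : R :=
  \sum_(A in edges G)
    2 * Num.sqrt (\prod_(w in A) (degree w)%:R) / \sum_(w in A) (degree w)%:R.

Definition randic (b : R) : R :=
  \sum_(A in edges G) (\prod_(w in A) (degree w)%:R) `^ b.

(* The two formulas agree at a = 1, see [k_constE_ge1]. *)
Definition k_const (a : R) : R :=
  let D := (max_degree G)%:R in let d := (min_degree G)%:R in
  if a <= 1 then 2 * D `^ (1 / 2) * d `^ (3 / 2) / (D ^+ 2 + d ^+ 2)
  else 2 * D `^ (a - 1 / 2) * d `^ (a + 1 / 2) / (D `^ (2 * a) + d `^ (2 * a)).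

Lemma k_constE_ge1 (a : R) : 1 <= a ->
  let D := (max_degree G)%:R in let d := (min_degree G)%:R in
  k_const a =
  2 * D `^ (a - 1 / 2) * d `^ (a + 1 / 2) / (D `^ (2 * a) + d `^ (2 * a)).
Proof.
move=> a1 /=; rewrite /k_const; case: ifPn => // a1'.
have -> : a = 1 by apply/eqP; rewrite eq_le a1' a1.
have -> : 1 - 1 / 2 = 1 / 2 :> R by rewrite [X in X - _](splitr 1) addrK.
have -> : 1 + 1 / 2 = 3 / 2 :> R.
  by rewrite -[X in X + _](@divff _ 2) ?pnatr_eq0// -mulrDl natr1.
by rewrite mulr1 !powR_mulrn.
Qed.

End Indices.

(* Main.v *)
(* Let d and D be the least and largest degree, m the number of edges and
   c = sqrt (d / D). Every term 2 sqrt (x y) / (x + y) of GA_1 lies in [c, 1]: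
   it is 1 only for x = y, and it is c only for d = D. Hence
   c m <= GA_1 <= m, with equality cases deciding regularity (on the right, by
   connectedness). On the other side Cauchy-Schwarz gives
   m <= sqrt (R_a R_-a), and Kantorovich's inequality gives
   sqrt (R_a R_-a) <= m cosh (a L) with L = ln (D / d), while
   k_a = c / cosh (max (a, 1) L); so k_a sqrt (R_a R_-a) <= c m. *)

Require Import Defs.
From HB Require Import structures.
From mathcomp Require Import all_boot all_order all_algebra.
From mathcomp Require Import reals exp.
From mathcomp Require Import ring lra.
Set Implicit Arguments.
Unset Strict Implicit.
Unset Printing Implicit Defensive.
Import Order.TTheory GRing.Theory Num.Theory.
Local Open Scope ring_scope.

(** * Sums of positive numbers against sums of their reciprocals *)

(** Each reciprocal lies above its tangents: 2 l - l^2 z <= 1 / z because (l z - 1)^2 >= 0. Summing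
    leaves one free parameter l to optimise. *)
Lemma sqrtrM_cauchy_schwarz (R : rcfType) (I : finType) (P : pred I)
    (z : I -> R) (i0 : I) :
  P i0 -> (forall i, P i -> 0 < z i) ->
  \sum_(i | P i) 1 <=
    Num.sqrt ((\sum_(i | P i) z i) * (\sum_(i | P i) (z i)^-1)).
Proof.
move=> Pi0 z_gt0; set m := \sum_(i | P i) 1.
set S := \sum_(i | P i) z i; set T := \sum_(i | P i) (z i)^-1.
have S_gt0 : 0 < S.
  rewrite /S (bigD1 i0)//= ltr_wpDr ?z_gt0 ?sumr_ge0// => i /andP[Pi _].
  exact/ltW/z_gt0.
have m_ge0 : 0 <= m by rewrite sumr_ge0.
have tangent_le l : 2 * l * m - l ^+ 2 * S <= T.
  rewrite /m /S /T !mulr_sumr -sumrB ler_sum// => i Pi.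
  have zi_gt0 := z_gt0 i Pi.
  rewrite mulr1 -[(z i)^-1]mul1r ler_pdivlMr//.
  by have := sqr_ge0 (l * z i - 1); nra.
rewrite -[leLHS]ger0_norm// -sqrtr_sqr ler_wsqrtr//.
(* The choice l = m / S maximises 2 l m - l^2 S, with value m^2 / S. *)
have := tangent_le (m / S); rewrite -(ler_pM2l S_gt0).
by congr (_ <= _); field; rewrite gt_eqF.
Qed.

(** On [A^2, B^2] the convex function 1 / z lies below its chord, that is, (z - A^2) (B^2 - z) >= 0.
    After summation, AM-GM for S and A^2 B^2 T brings in the square root of S T. *)
Lemma sqrtrM_kantorovich (R : rcfType) (I : finType) (P : pred I)
    (z : I -> R) (A B : R) :
  0 < A -> 0 < B -> (forall i, P i -> A ^+ 2 <= z i <= B ^+ 2) ->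
  2 * (A * B) * Num.sqrt ((\sum_(i | P i) z i) * (\sum_(i | P i) (z i)^-1)) <=
    (A ^+ 2 + B ^+ 2) * \sum_(i | P i) 1.
Proof.
move=> A_gt0 B_gt0 zAB; set m := \sum_(i | P i) 1.
have z_gt0 i : P i -> 0 < z i.
  by move=> /zAB/andP[+ _]; apply: lt_le_trans; rewrite exprn_gt0.
set S := \sum_(i | P i) z i; set T := \sum_(i | P i) (z i)^-1.
have S_ge0 : 0 <= S by rewrite sumr_ge0// => i /z_gt0/ltW.
have T_ge0 : 0 <= T by rewrite sumr_ge0// => i /z_gt0/ltW; rewrite invr_ge0.
have chord_ge : S + A ^+ 2 * B ^+ 2 * T <= (A ^+ 2 + B ^+ 2) * m.
  rewrite /m /S /T !mulr_sumr -big_split ler_sum// => i Pi /=.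
  have zi_gt0 := z_gt0 i Pi; have /andP[zA zB] := zAB i Pi.
  rewrite mulr1 -(ler_pM2r zi_gt0) mulrDl divfK ?gt_eqF//.
  by nra.
apply: le_trans chord_ge.
have AB_ge0 : 0 <= A * B by rewrite mulr_ge0// ltW.
rewrite sqrtrM//.
have := sqr_sqrtr S_ge0; have := sqr_sqrtr T_ge0.
set s := Num.sqrt S; set t := Num.sqrt T => <- <-.
by have := sqr_ge0 (s - A * B * t); nra.
Qed.

(** * The ratio of the geometric to the arithmetic mean *)

Section GeometricArithmeticRatio.
Variables (R : rcfType) (x y : R).
Hypotheses (x_gt0 : 0 < x) (y_gt0 : 0 < y).

Lemma ga_ratioE : 2 * Num.sqrt (x * y) / (x + y) =
  1 - (Num.sqrt x - Num.sqrt y) ^+ 2 / (x + y).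
Proof.
rewrite sqrtrM ?ltW//.
have := sqr_sqrtr (ltW x_gt0); have := sqr_sqrtr (ltW y_gt0).
have nz : x + y != 0 by rewrite gt_eqF ?addr_gt0.
move: nz; move: (Num.sqrt x) (Num.sqrt y) => s t nz tE sE; move: nz.
by rewrite -sE -tE => nz; field.
Qed.

Lemma ga_ratio_le1 : 2 * Num.sqrt (x * y) / (x + y) <= 1 ?= iff (x == y).
Proof.
rewrite ga_ratioE; apply/leifP; case: eqVneq => [->|xy].
  by rewrite subrr expr0n mul0r subr0.
rewrite ltrBlDr ltrDl divr_gt0 ?addr_gt0// exprn_even_gt0//= subr_eq0.
by rewrite eqr_sqrt ?ltW.
Qed.

End GeometricArithmeticRatio.

(** Let f <= v <= u <= F be the square roots of d <= y <= x <= D. Then f u^2 <= F u v since f <= v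
    and u <= F, and f v^2 <= F u v since f <= F and v <= u, strictly when d < D. Adding the two
    gives the bound; when d = D both sides are 1. *)
Lemma ga_ratio_ge (R : rcfType) (d D x y : R) : 0 < d ->
  d <= x <= D -> d <= y <= D ->
  Num.sqrt d / Num.sqrt D <= 2 * Num.sqrt (x * y) / (x + y) ?= iff (d == D).
Proof.
move=> d_gt0; wlog yx : x y / y <= x => [hwlog|] xdD ydD.
  have [yx|/ltW xy] := leP y x; first exact: hwlog.
  by rewrite [x * y]mulrC [x + y]addrC; exact: hwlog.
have [/andP[dx xD] /andP[dy yD]] := (xdD, ydD).
have x_gt0 := lt_le_trans d_gt0 dx; have y_gt0 := lt_le_trans d_gt0 dy.
have D_gt0 := lt_le_trans x_gt0 xD.
apply/leifP; case: eqVneq => [dD|d_neq_D].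
  have -> : x = D by apply/eqP; rewrite eq_le xD -dD dx.
  have -> : y = D by apply/eqP; rewrite eq_le yD -dD dy.
  rewrite dD divff ?sqrtr_eq0 -?ltNge//.
  rewrite -expr2 sqrtr_sqr gtr0_norm// mulr_natl mulr2n divff//.
  by rewrite gt_eqF ?addr_gt0.
have dD : d < D by rewrite lt_neqAle d_neq_D (le_trans dx).
rewrite ltr_pdivrMr ?sqrtr_gt0// mulrAC ltr_pdivlMr ?addr_gt0// sqrtrM ?ltW//.
rewrite -[X in X + y]sqr_sqrtr ?ltW// -[X in _ + X]sqr_sqrtr ?ltW//.
have sdD : Num.sqrt d < Num.sqrt D by rewrite ltr_sqrt.
have syx : Num.sqrt y <= Num.sqrt x by rewrite ler_wsqrtr.
have sdy : Num.sqrt d <= Num.sqrt y by rewrite ler_wsqrtr.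
have sxD : Num.sqrt x <= Num.sqrt D by rewrite ler_wsqrtr.
move: sdD syx sdy sxD (sqrtr_gt0 d) (sqrtr_gt0 y).
rewrite d_gt0 y_gt0.
move: (Num.sqrt d) (Num.sqrt D) (Num.sqrt x) (Num.sqrt y).
move=> f F u v fF vu fv uF f_gt0 v_gt0.
have u_gt0 : 0 < u by lra.
have fuu : f * u * u <= v * F * u by rewrite ler_pM2r// ler_pM// ltW.
have fvv : f * v * v < F * u * v by rewrite ltr_pM2r//; nra.
by nra.
Qed.

Lemma big_set2 (R : Type) (idx : R) (op : Monoid.com_law idx) (I : finType)
    (i j : I) (F : I -> R) :
  i != j -> \big[op/idx]_(k in [set i; j]) F k = op (F i) (F j).
Proof. by move=> ij; rewrite big_setU1 ?inE//= big_set1. Qed.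

(** * Edges, connectedness and extreme degrees *)

Section GraphDegrees.
Variable G : sgraph.
Implicit Types (u v : G) (A : {set G}).

Lemma edgesP A :
  reflect (exists u v, adj u v /\ A = [set u; v]) (A \in edges G).
Proof.
apply: (iffP imset2P) => [[u v _]|[u [v [uv ->]]]].
  by rewrite !inE => /andP[_ uv] ->; exists u, v.
by exists u v; rewrite ?inE.
Qed.

Lemma adj_neq u v : adj u v -> u != v.
Proof. by apply: contraTN => /eqP ->; rewrite adj_irrefl. Qed.

Lemma degree_gt0_adj u v : adj u v -> (0 < degree u)%N.
Proof. by move=> uv; apply/card_gt0P; exists v; rewrite inE. Qed.

(** A level set of [f] is closed under adjacency, hence under [connect]. This serves for the
    positivity of degrees and, when the upper bound is attained, for the degree itself. *)
Lemma connected_invariant (T : eqType) (f : G -> T) : graph_connected G ->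
  (forall u v, adj u v -> f u = f v) -> forall u v, f u = f v.
Proof.
move=> conn fadj u v.
have clf : closed (@adj G) [pred w | f w == f u].
  by move=> w w' ww'; rewrite !inE (fadj _ _ ww').
by have := closed_connect clf (conn u v); rewrite !inE eqxx => /esym/eqP.
Qed.

Lemma connected_degree_gt0 : graph_connected G -> edges G != set0 ->
  forall u, (0 < degree u)%N.
Proof.
move=> conn /set0Pn[_ /edgesP[x [y [xy _]]]] u.
(* Both ends of an edge have positive degree, so the boolean [0 < degree v] is constant along edges,
   and it is true at [x]. *)
rewrite (@connected_invariant _ (fun v => 0 < degree v)%N conn _ u x).
  exact: degree_gt0_adj xy.
move=> v w vw; rewrite (degree_gt0_adj vw).
by rewrite adj_sym in vw; rewrite (degree_gt0_adj vw).
Qed.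

Lemma min_degree_le u : (min_degree G <= degree u)%N.
Proof. by rewrite /min_degree -minEnat -leEnat bigmin_le. Qed.

Lemma le_max_degree u : (degree u <= max_degree G)%N.
Proof. exact: leq_bigmax. Qed.

Lemma min_degree_gt0 : (0 < #|G|)%N ->
  (forall u, (0 < degree u)%N) -> (0 < min_degree G)%N.
Proof.
move=> G_gt0 deg_gt0; rewrite /min_degree.
by elim/big_ind: _ => // m n m_gt0 n_gt0; rewrite leq_min m_gt0.
Qed.

Lemma min_max_degree_regular : min_degree G = max_degree G -> graph_regular G.
Proof.
move=> dD; exists (max_degree G) => u; apply/eqP.
by rewrite eqn_leq le_max_degree -dD min_degree_le.
Qed.

Lemma regular_min_max_degree u : graph_regular G ->
  min_degree G = max_degree G.
Proof.
case=> k degk; apply/eqP; rewrite eqn_leq.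
rewrite (leq_trans (min_degree_le u) (le_max_degree u))/=.
have -> : max_degree G = k.
  apply/eqP; rewrite eqn_leq -{2}(degk u) le_max_degree andbT.
  by apply/bigmax_leqP => v _; rewrite degk.
rewrite /min_degree; elim/big_ind: _ => [|m n km kn|v _]; last by rewrite degk.
(* The default value [#|G|] of the minimum is at least every degree. *)
- by rewrite -(degk u) max_card.
- by rewrite leq_min km.
Qed.

End GraphDegrees.

(** * Comparison of the indices with the number of edges *)

(** Extracts the factor c from the numerator of [k_const]; what remains is symmetric in d and D. *)
Lemma powR_half_split (R : realType) (d D b : R) : 0 < d -> 0 < D ->
  D `^ (b - 1 / 2) * d `^ (b + 1 / 2) =
  D `^ b * d `^ b * (Num.sqrt d / Num.sqrt D).
Proof.
move=> d_gt0 D_gt0; rewrite !div1r powRB; last first.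
  by rewrite (gt_eqF D_gt0) implybT.
rewrite powRD; last by rewrite (gt_eqF d_gt0) implybT.
by rewrite !powR12_sqrt ?ltW//; ring.
Qed.

Section MainBounds.
Variables (R : realType) (G : sgraph) (a : R).
Hypotheses (conn : graph_connected G) (edge : edges G != set0) (a_gt0 : 0 < a).

Let D : R := (max_degree G)%:R.
Let d : R := (min_degree G)%:R.
Let c : R := Num.sqrt d / Num.sqrt D.
Let m : R := \sum_(A in edges G) 1.
Let S := randic G a * randic G (- a).

Let vertex0 : exists u : G, True.
Proof. by have /set0Pn[_ /edgesP[u _]] := edge; exists u. Qed.

Let d_gt0 : 0 < d.
Proof.
have [u _] := vertex0; rewrite ltr0n min_degree_gt0//; last first.
  exact: connected_degree_gt0.
by apply/card_gt0P; exists u.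
Qed.

Let degree_bounds (u : G) : d <= (degree u)%:R <= D.
Proof. by rewrite !ler_nat min_degree_le le_max_degree. Qed.

Let degree_gt0 (u : G) : 0 < (degree u)%:R :> R.
Proof. by have /andP[+ _] := degree_bounds u; exact: lt_le_trans. Qed.

Let dD : d <= D.
Proof.
have [u _] := vertex0.
by have /andP[] := degree_bounds u; exact: le_trans.
Qed.

Let D_gt0 : 0 < D. Proof. exact: lt_le_trans dD. Qed.

Let m_gt0 : 0 < m.
Proof.
have /set0Pn[A EA] := edge; rewrite /m (bigD1 A)//=.
by rewrite ltr_wpDr// sumr_ge0.
Qed.

(** The equality condition quantifies over pairs of members of [A] because an edge is an unordered
    set without chosen ends. *)
Lemma GA1_le_size : GA1 R G <= m ?= iff
  [forall A in edges G, [forall u in A, forall v in A, degree u == degree v]].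
Proof.
rewrite /GA1 /m; apply: leif_sum => A /edgesP[u [v [uv ->]]].
rewrite !big_set2 ?adj_neq//.
have -> : [forall x in [set u; v], forall y in [set u; v], degree x == degree y]
    = ((degree u)%:R == (degree v)%:R :> R).
  rewrite eqr_nat; apply/forall_inP/idP => [uvP|/eqP uvE x].
    by have /forall_inP := uvP u (set21 u v); apply; rewrite set22.
  move=> xuv; apply/forall_inP => y yuv.
  by move: xuv yuv; rewrite !inE => /orP[]/eqP-> /orP[]/eqP->; rewrite ?uvE.
exact: ga_ratio_le1.
Qed.

Lemma GA1_ge_size : c * m <= GA1 R G ?= iff (d == D).
Proof.
have /set0Pn[A0 EA0] := edge.
(* [leif_sum] yields a conjunction over the edges; its terms are all [d == D], and the edge [A0]
   keeps it from being vacuous. *)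
have -> : (d == D) = [forall A in edges G, d == D].
  by apply/idP/forall_inP => [-> //|/(_ _ EA0)].
rewrite /GA1 /m mulr_sumr; apply: leif_sum => A /edgesP[u [v [uv ->]]].
by rewrite mulr1 !big_set2 ?adj_neq//; exact: ga_ratio_ge.
Qed.

(** With these weights the two Randić indices become a sum and the sum of the reciprocals, as both
    inequalities on sums require. *)
Let edge_weight (A : {set G}) := (\prod_(w in A) (degree w)%:R : R) `^ a.

Let randic_prodE : S =
  (\sum_(A in edges G) edge_weight A) *
  (\sum_(A in edges G) (edge_weight A)^-1).
Proof. by congr (_ * _); apply: eq_bigr => A _; rewrite powRN. Qed.

Let edge_weight_bounds A : A \in edges G ->
  (d `^ a) ^+ 2 <= edge_weight A <= (D `^ a) ^+ 2.
Proof.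
move=> /edgesP[u [v [uv ->]]]; rewrite /edge_weight big_set2 ?adj_neq//.
rewrite powRM ?ler0n// !expr2.
have /andP[du uD] := degree_bounds u; have /andP[dv vD] := degree_bounds v.
by rewrite !ler_pM ?powR_ge0// ge0_ler_powR// ?nnegrE ?ler0n// ltW.
Qed.

Lemma size_le_randic : m <= Num.sqrt S.
Proof.
have /set0Pn[A0 EA0] := edge; rewrite randic_prodE.
apply: (sqrtrM_cauchy_schwarz EA0) => A /edge_weight_bounds/andP[+ _].
by apply: lt_le_trans; rewrite exprn_gt0// powR_gt0.
Qed.

(** For a <= 1 the constant does not depend on a and equals its value at 1, so one formula at
    exponent [Num.max a 1] covers both cases. *)
Lemma k_const_max :
  k_const G a = 2 * (D `^ Num.max a 1 * d `^ Num.max a 1 * c)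
    / ((D `^ Num.max a 1) ^+ 2 + (d `^ Num.max a 1) ^+ 2).
Proof.
have -> : k_const G a = k_const G (Num.max a 1).
  rewrite /k_const; case: (leP a 1) => a1; first by rewrite lexx.
  by rewrite leNgt a1.
rewrite k_constE_ge1 ?le_max ?lexx ?orbT//= -/D -/d.
rewrite -!(mulrA 2) powR_half_split// ![2 * Num.max _ _]mulrC !powRrM.
by rewrite !powR_mulrn ?powR_ge0.
Qed.

(** Kantorovich's inequality comes with exponent a, the constant with [Num.max a 1]. Writing the
    latter as a + r with r >= 0 separates the factors that bridge the gap. *)
Lemma k_const_randic_le : k_const G a * Num.sqrt S <= c * m.
Proof.
have c_ge0 : 0 <= c by rewrite divr_ge0 ?sqrtr_ge0.
have dDpow r : 0 <= r -> d `^ r <= D `^ r.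
  by move=> r_ge0; rewrite ge0_ler_powR ?nnegrE ?ler0n.
have := sqrtrM_kantorovich (powR_gt0 a d_gt0) (powR_gt0 a D_gt0)
  edge_weight_bounds.
rewrite -randic_prodE -/m k_const_max.
have := dDpow a (ltW a_gt0).
have := dDpow (Num.max a 1 - a); rewrite subr_ge0 le_max lexx => /(_ isT).
have powE x : 0 < x -> x `^ Num.max a 1 = x `^ a * x `^ (Num.max a 1 - a).
  by move=> x_gt0; rewrite -powRD ?(gt_eqF x_gt0) ?implybT// addrC subrK.
rewrite !powE//.
move: (powR_gt0 a d_gt0) (powR_gt0 a D_gt0).
move: (powR_gt0 (Num.max a 1 - a) d_gt0) (powR_gt0 (Num.max a 1 - a) D_gt0).
(* From here A = d^a, B = D^a, F = d^r and E = D^r with r = [Num.max a 1 - a]. *)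
move: (d `^ a) (D `^ a) (d `^ _) (D `^ _) (Num.sqrt S) => A B F E s.
move=> F_gt0 E_gt0 A_gt0 B_gt0 FE AB kanto.
rewrite mulrAC ler_pdivrMr ?addr_gt0 ?exprn_gt0 ?mulr_gt0//.
(* Up to the factor 2 A B E F, this is cosh (a L) <= cosh ((a + r) L). *)
have EF_le : (A ^+ 2 + B ^+ 2) * (E * F) <= (B * E) ^+ 2 + (A * F) ^+ 2.
  rewrite -subr_ge0.
  have -> : (B * E) ^+ 2 + (A * F) ^+ 2 - (A ^+ 2 + B ^+ 2) * (E * F) =
    (E - F) * (B ^+ 2 * E - A ^+ 2 * F) by ring.
  rewrite mulr_ge0 ?subr_ge0// ler_pM ?sqr_ge0 ?(ltW F_gt0)//.
  by rewrite lerXn2r ?nnegrE ?(ltW A_gt0) ?(ltW B_gt0).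
have -> : 2 * (B * E * (A * F) * c) * s = c * ((E * F) * (2 * (A * B) * s)).
  by ring.
rewrite -(mulrA c) ler_wpM2l//.
apply: (@le_trans _ _ (E * F * ((A ^+ 2 + B ^+ 2) * m))).
  by rewrite ler_pM2l ?mulr_gt0.
by rewrite mulrA [E * F * _]mulrC [leRHS]mulrC ler_pM2r.
Qed.

Lemma regular_k_const_randic :
  graph_regular G -> k_const G a * Num.sqrt S = m /\ Num.sqrt S = m.
Proof.
have [u _] := vertex0 => /(regular_min_max_degree u) dDn.
have dDE : d = D by rewrite /d dDn.
have k1 : k_const G a = 1.
  rewrite k_const_max /c dDE divff ?sqrtr_eq0 -?ltNge// mulr1.
  have := powR_gt0 (Num.max a 1) D_gt0; move: (D `^ _) => t t_gt0.
  rewrite -expr2 mulr_natl mulr2n divff//.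
  by rewrite gt_eqF ?addr_gt0 ?exprn_gt0.
rewrite k1 mul1r; suff -> : Num.sqrt S = m by [].
(* Since k = c = 1 here, the preceding bound gives the reverse inequality. *)
apply/eqP; rewrite eq_le size_le_randic andbT.
have := k_const_randic_le; rewrite k1 /c dDE divff ?mul1r//.
by rewrite sqrtr_eq0 -ltNge.
Qed.

End MainBounds.

Theorem theorem2p13 (R : realType) (G : sgraph) (a : R) :
  graph_connected G -> edges G != set0 -> 0 < a ->
  [/\ k_const G a * Num.sqrt (randic G a * randic G (- a)) <= GA1 R G,
      GA1 R G <= Num.sqrt (randic G a * randic G (- a)),
      k_const G a * Num.sqrt (randic G a * randic G (- a)) = GA1 R G
        <-> graph_regular G
    & GA1 R G = Num.sqrt (randic G a * randic G (- a)) <-> graph_regular G].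
Proof.
move=> conn edge a_gt0.
have kS := k_const_randic_le conn edge a_gt0.
have mS := size_le_randic conn edge a_gt0.
have [GA_le GA_eq] := GA1_le_size R conn edge.
have [GA_ge GA_geE] := GA1_ge_size R conn edge.
have reg_GA : graph_regular G -> GA1 R G = \sum_(A in edges G) 1.
  move=> [k degk]; apply/eqP; rewrite GA_eq.
  apply/forall_inP => A _; apply/forall_inP => u _; apply/forall_inP => v _.
  by rewrite !degk.
have reg := regular_k_const_randic conn edge a_gt0.
split.
- exact: le_trans GA_ge.
- exact: le_trans mS.
(* Equality collapses the chain through c m, so GA_1 = c m and the extreme degrees agree. *)
- split=> [kSE|Greg]; last by rewrite (reg Greg).1 reg_GA.
  apply: min_max_degree_regular; apply/eqP; rewrite -(eqr_nat R) -GA_geE.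
  by rewrite eq_le GA_ge -kSE.
(* Equality collapses the chain through m, so GA_1 = m and degrees agree along each edge;
   connectedness spreads this to all vertices. *)
- split=> [SE|Greg]; last by rewrite (reg Greg).2 reg_GA.
  have : GA1 R G == \sum_(A in edges G) 1 by rewrite eq_le GA_le SE.
  rewrite GA_eq => /forall_inP edge_eq.
  have /set0Pn[_ /edgesP[u0 _]] := edge.
  exists (degree u0) => u; apply: connected_invariant => // {}u v uv.
  have uvE : [set u; v] \in edges G by apply/edgesP; exists u, v.
  have /forall_inP/(_ u (set21 u v))/forall_inP := edge_eq _ uvE.
  by move=> /(_ v (set22 u v))/eqP.
Qed.
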